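(* Let $m,n$ be positive integers, let $f$ be a positive continuous decreasing function on $\mathbb{R}_+$ with inverse function $f^{-1}$ and $f(T)\to0$ as $T\to\infty$, and let $g(T)=\dfrac1{f^{-1}(1/T)}$. Suppose there is $\gamma>0$ such that $f(CT)\le C^{-\gamma}f(T)$ for all $T>0$ and all sufficiently large $C>1$. Let $\Theta$ be a real $n\times m$ matrix such that $\Theta^\top$ is $f$-Dirichlet, and let $\Omega$ be the set of all asymptotic directions for the best approximations of $\Theta^\top$. Let $\mathcal A$ be an affine subspace of $\mathbb{R}^n$ of positive dimension, with corresponding linear subspace $\mathcal L$ and orthogonal complement $\mathcal L^\perp$. If $\Theta^\top$ is trivially singular, assume also that $\mathcal A$ is not exceptional. If $\mathcal L^\perp\cap\Omega=\emptyset$, then the set $\widehat{\mathbf{BA}}^{\Theta}_{n,m}[g]\cap\mathcal A$ is HAW in $\mathcal A$. In particular, the set $\widehat{\mathbf{BA}}^{\Theta}_{n,m}[g]$ is HAW.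
   Context: $|\cdot|$ is the supremum norm; $\|\mathbf v\|_{\mathbb{Z}^k}=\min_{\mathbf p\in\mathbb{Z}^k}|\mathbf v-\mathbf p|$. A real $a\times b$ matrix $\Phi$ is $F$-Dirichlet if for all sufficiently large $T$ there is $\mathbf x\in\mathbb{Z}^b\setminus\{\mathbf 0\}$ with $\|\Phi\mathbf x\|_{\mathbb{Z}^a}^a\le F(T)$ and $|\mathbf x|^b\le T$ (for $\Theta^\top$: $a=m$, $b=n$). $\widehat{\mathbf{BA}}^{\Theta}_{n,m}[g]$ is the set of $\pmb\eta\in\mathbb{R}^n$ with $\liminf_{|\mathbf q|\to\infty,\ \mathbf q\in\mathbb{Z}^m}\dfrac{\|\Theta\mathbf q-\pmb\eta\|_{\mathbb{Z}^n}^n}{g(|\mathbf q|^m)}>0$. $\Theta^\top$ is trivially singular if $\Theta^\top\mathbf z\in\mathbb{Z}^m$ for some nonzero $\mathbf z\in\mathbb{Z}^n$; in that case $\mathcal A$ is exceptional if it is contained in a hyperplane $\{\pmb\eta\in\mathbb{R}^n:\pmb\eta\cdot\mathbf z=a\}$ with $a\in\mathbb{Z}$ and $\mathbf z\in\mathbb{Z}^n\setminus\{\mathbf 0\}$, $\Theta^\top\mathbf z\in\mathbb{Z}^m$. If $\Theta^\top$ is not trivially singular, put $\psi_{\Theta^\top}(t)=\min_{\mathbf y\in\mathbb{Z}^n,\,0<|\mathbf y|\le t}\|\Theta^\top\mathbf y\|_{\mathbb{Z}^m}$; the best approximation vectors $\mathbf y_\nu\in\mathbb{Z}^n$, with $Y_\nu=|\mathbf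 y_\nu|$, $1=Y_1<Y_2<\dots$, satisfy $\psi_{\Theta^\top}(t)=\|\Theta^\top\mathbf y_\nu\|_{\mathbb{Z}^m}$ for $Y_\nu\le t<Y_{\nu+1}$, with $\psi_{\Theta^\top}(Y_\nu)$ strictly decreasing. An asymptotic direction is a limit, along a subsequence of $\nu$, of the unit vectors $\pm\mathbf y_\nu$ (normalized to lie on the unit sphere $S^{n-1}$). If $\Theta^\top$ is trivially singular, $\Omega=\emptyset$. HAW (hyperplane absolute winning): for $0<\beta<\frac13$, in the $\beta$-hyperplane absolute game on $\mathbb{R}^d$ Bob first chooses a closed ball $B_0$ of radius $r_0>0$; at stage $i\ge0$ Alice chooses an affine hyperplane $H_i$ and $0<\epsilon_i\le\beta r_i$, and Bob then chooses a closed ball $B_{i+1}\subset B_i$ disjoint from the $\epsilon_i$-neighborhood of $H_i$, of radius $r_{i+1}\ge\beta r_i$. A set $S$ is HAW if for every $0<\beta<\frac13$ Alice has a strategy guaranteeing $S\cap\bigcap_iB_i\ne\emptyset$. ''HAW in $\mathcal A$'' means the same with $\mathcal A$ identified isometrically with $\mathbb{R}^{\dim\mathcal A}$. *)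

(* Defs.v *)
From HB Require Import structures.
From mathcomp Require Import all_boot all_order all_algebra.
From mathcomp Require Import all_classical all_reals all_analysis.

Set Implicit Arguments.
Unset Strict Implicit.
Unset Printing Implicit Defensive.

Import Order.TTheory GRing.Theory Num.Theory.
Import numFieldNormedType.Exports.

Local Open Scope classical_set_scope.
Local Open Scope ring_scope.

(* Vectors are column vectors, and `|v| is the supremum norm: it is the norm
   of the library on matrices.  The Euclidean norm is [enorm]. *)

Definition Zvec (R : realType) (k : nat) (z : 'cV[int]_k) : 'cV[R]_k :=
  map_mx intr z.
Arguments Zvec R {k} z.

(* The infimum is attained: it is the minimum over the integer points. *)
Definition distZ (R : realType) (k : nat) (v : 'cV[R]_k) : R :=
  inf [set `|v - Zvec R p| | p in [set: 'cV[int]_k]].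

Definition dirichlet (R : realType) (a b : nat) (F : R -> R)
    (Phi : 'M[R]_(a, b)) : Prop :=
  \forall T \near +oo, exists x : 'cV[int]_b,
    [/\ x != 0, distZ (Phi *m Zvec R x) ^+ a <= F T & `|Zvec R x| ^+ b <= T].

Definition Zvec_infty (R : realType) (k : nat) : set_system 'cV[R]_k :=
  filter_from [set: R] (fun M => [set q | M <= `|q|] `&` range (@Zvec R k)).

(* The lower limit is taken in the extended reals; the value +oo is allowed. *)
Definition BA (R : realType) (n m : nat) (Theta : 'M[R]_(n, m)) (g : R -> R) :
    set 'cV[R]_n :=
  [set eta | (0 < limf_einf (fun q : 'cV[R]_m =>
      (distZ (Theta *m q - eta) ^+ n / g (`|q| ^+ m))%:E)
    (@Zvec_infty R m))%E].

Definition trivially_singular (R : realType) (a b : nat) (Phi : 'M[R]_(a, b)) :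
    Prop :=
  exists z : 'cV[int]_b, z != 0 /\ exists p, Phi *m Zvec R z = Zvec R p.

Definition dot (R : realType) (k : nat) (u v : 'cV[R]_k) : R :=
  (u^T *m v) 0 0.

Definition enorm (R : realType) (k : nat) (v : 'cV[R]_k) : R :=
  Num.sqrt (dot v v).

Definition affine_subspace (R : realType) (n : nat) (a : 'cV[R]_n)
    (L : {vspace 'cV[R]_n}) : set 'cV[R]_n :=
  [set a + u | u in [set u | u \in L]].

Definition orthogonal_complement (R : realType) (n : nat)
    (L : {vspace 'cV[R]_n}) : set 'cV[R]_n :=
  [set v | forall u, u \in L -> dot u v = 0].

Definition exceptional (R : realType) (m n : nat) (Phi : 'M[R]_(m, n))
    (A : set 'cV[R]_n) : Prop :=
  exists (z : 'cV[int]_n) (a : int),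
    [/\ z != 0, exists p, Phi *m Zvec R z = Zvec R p &
        A `<=` [set eta | dot eta (Zvec R z) = a%:~R]].

(* For 1 <= t the infimum is attained, as the set is finite and nonempty. *)
Definition psi (R : realType) (a b : nat) (Phi : 'M[R]_(a, b)) (t : R) : R :=
  inf [set distZ (Phi *m Zvec R y) |
       y in [set y : 'cV[int]_b | 0 < `|Zvec R y| <= t]].

(* The sequence is indexed from 0.  It is not unique: besides the signs, several
   vectors of the same norm may realize the minimum. *)
Definition best_approximations (R : realType) (a b : nat)
    (Phi : 'M[R]_(a, b)) (y : nat -> 'cV[int]_b) : Prop :=
  [/\ `|Zvec R (y 0%N)| = 1,
      forall i, `|Zvec R (y i)| < `|Zvec R (y i.+1)|,
      forall i t, `|Zvec R (y i)| <= t < `|Zvec R (y i.+1)| ->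
        psi Phi t = distZ (Phi *m Zvec R (y i)) &
      forall i, psi Phi `|Zvec R (y i.+1)| < psi Phi `|Zvec R (y i)|].

Definition asymptotic_directions (R : realType) (a b : nat)
    (Phi : 'M[R]_(a, b)) (y : nat -> 'cV[int]_b) : set 'cV[R]_b :=
  [set v | ~ trivially_singular Phi /\
    exists (k : nat -> nat) (s : nat -> bool),
      (forall i j, (i < j)%N -> (k i < k j)%N) /\
      ((-1) ^+ s j *: ((enorm (Zvec R (y (k j))))^-1 *: Zvec R (y (k j)))
         @[j --> \oo] --> v)].

Section Game.
Variables (R : realType) (d : nat).

(* A closed ball is given by its center and its radius. *)
Definition cball (b : 'cV[R]_d * R) : set 'cV[R]_d :=
  [set x | enorm (x - b.1) <= b.2].

Definition hyperplane (H : set 'cV[R]_d) : Prop :=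
  exists (w : 'cV[R]_d) (c : R), w != 0 /\ H = [set x | dot x w = c].

Definition neighborhood (H : set 'cV[R]_d) (e : R) : set 'cV[R]_d :=
  [set x | exists2 h, H h & enorm (x - h) < e].

(* A strategy maps the balls B_0, ..., B_i played so far to the hyperplane H_i
   and the number epsilon_i. *)
Definition strategy := seq ('cV[R]_d * R) -> set 'cV[R]_d * R.

(* Legality is required against every history, not only along infinite plays:
   otherwise Alice could win by an illegal move that leaves Bob no answer. *)
Definition legal_strategy (beta : R) (sigma : strategy) : Prop :=
  forall h b, 0 < b.2 ->
    hyperplane (sigma (rcons h b)).1 /\ 0 < (sigma (rcons h b)).2 <= beta * b.2.

Definition bob_plays (beta : R) (sigma : strategy) (B : nat -> 'cV[R]_d * R) :
    Prop :=
  0 < (B 0%N).2 /\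
  forall i, let: (H, e) := sigma (mkseq B i.+1) in
    [/\ cball (B i.+1) `<=` cball (B i),
        cball (B i.+1) `&` neighborhood H e = set0 &
        beta * (B i).2 <= (B i.+1).2].

Definition HAW (S : set 'cV[R]_d) : Prop :=
  forall beta : R, 0 < beta < 3%:R^-1 ->
    exists2 sigma : strategy, legal_strategy beta sigma &
      forall B, bob_plays beta sigma B ->
        S `&` \bigcap_i cball (B i) !=set0.

End Game.

(* [phi] is the isometric identification of R^d with A; as HAW is invariant
   under isometries of R^d, its choice does not matter. *)
Definition HAW_in (R : realType) (n d : nat) (A S : set 'cV[R]_n) : Prop :=
  exists phi : 'cV[R]_d -> 'cV[R]_n,
    [/\ forall x y, enorm (phi x - phi y) = enorm (x - y),
        range phi = A & HAW (phi @^-1` S)].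

(* Main.v *)
Require Import Defs.
From HB Require Import structures.
From mathcomp Require Import all_boot all_order all_algebra.
From mathcomp Require Import all_classical all_reals all_analysis.
From mathcomp Require Import ring lra.

Set Implicit Arguments.
Unset Strict Implicit.
Unset Printing Implicit Defensive.

Import Order.TTheory GRing.Theory Num.Theory.
Import numFieldNormedType.Exports.

Local Open Scope classical_set_scope.
Local Open Scope ring_scope.

(** Write y_nu for the best approximations of the transpose of Theta. If the
   product of eta with an integer vector z stays at distance at least delta from the
   integers, then ([transference])

     delta <= n |z| ||Theta q - eta|| + m |q| ||Theta^T z||   for every q.

   Suppose this holds for a family of vectors z, one for each large power of some
   lambda > 1, of norm at most that power t and with ||Theta^T z||^m <= f (t^n).
   Given q, let U satisfy f U = 1/|q|^m, so that g (|q|^m) = 1/U. The growth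
   condition on f makes the last term at most delta/2 as soon as t^n >= C U for a
   suitable constant C; with the first such t, the other term gives a lower bound for
   ||Theta q - eta||^n of order 1/U ([BA_of_approximations]). The last best
   approximation below t is such a z, because Theta^T is f-Dirichlet; if Theta^T is
   trivially singular, a single z with Theta^T z integral serves all t.

   It remains to see that Alice can keep the point away from these hyperplanes. The
   affine subspace is parametrized by x |-> a + M x, where the columns of M are an
   orthonormal basis of L, so the hyperplanes in the game have normal vectors M^T z.
   By compactness, the absence of asymptotic directions in the orthogonal complement
   of L implies that M^T y_nu has the same order of magnitude as y_nu
   ([projection_lower_bound]). With lambda = 1/beta, at most one of the vectors used
   has norm between two successive powers of lambda. So Alice deals with the j-th
   vector when the radius r is of order beta^j: at that moment the parallel
   hyperplanes are much farther apart than r, only one of them matters, and removing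
   its neighbourhood of half-width beta r in one move ensures a uniform delta.
   Since the radius never drops by more than a factor beta in one move, every vector
   has its turn ([away_from_integers_win]).

   In the trivially singular case, either M^T z is nonzero and the same game is played
   for the single vector z, or the product with z is constant on the affine subspace;
   this constant is not an integer as the subspace is not exceptional, and the whole
   subspace lies in the set. *)

(** * The Euclidean norm and the sup norm *)

Section Euclidean.
Variables (R : realType) (k : nat).
Implicit Types (u v w : 'cV[R]_k) (a : R).

Lemma dotE u v : dot u v = \sum_i u i 0 * v i 0.
Proof. by rewrite /dot mxE; apply: eq_bigr => i _; rewrite mxE. Qed.

Lemma dotC u v : dot u v = dot v u.
Proof. by rewrite !dotE; apply: eq_bigr => i _; rewrite mulrC. Qed.

Lemma dotDr u v w : dot u (v + w) = dot u v + dot u w.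
Proof. by rewrite /dot mulmxDr mxE. Qed.

Lemma dotBr u v w : dot u (v - w) = dot u v - dot u w.
Proof. by rewrite /dot mulmxBr !mxE. Qed.

Lemma dotZr a u v : dot u (a *: v) = a * dot u v.
Proof. by rewrite /dot -scalemxAr mxE. Qed.

Lemma dotDl u v w : dot (u + v) w = dot u w + dot v w.
Proof. by rewrite dotC dotDr !(dotC w). Qed.

Lemma dotBl u v w : dot (u - v) w = dot u w - dot v w.
Proof. by rewrite dotC dotBr !(dotC w). Qed.

Lemma dotZl a u v : dot (a *: u) v = a * dot u v.
Proof. by rewrite dotC dotZr dotC. Qed.

Lemma dot0r u : dot u 0 = 0.
Proof. by rewrite /dot mulmx0 mxE. Qed.

Lemma dot_ge0 u : 0 <= dot u u.
Proof. by rewrite dotE; apply: sumr_ge0 => i _; rewrite -expr2 sqr_ge0. Qed.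

Lemma dot_eq0 u : dot u u = 0 -> u = 0.
Proof.
rewrite dotE => /eqP; rewrite psumr_eq0 => [/allP u0|i _]; last first.
  by rewrite -expr2 sqr_ge0.
apply/matrixP => i j; rewrite ord1 mxE; apply/eqP.
by have := u0 i (mem_index_enum _); rewrite /= -expr2 sqrf_eq0.
Qed.

Lemma enorm_ge0 u : 0 <= enorm u. Proof. exact: sqrtr_ge0. Qed.

Lemma sqr_enorm u : enorm u ^+ 2 = dot u u.
Proof. by rewrite sqr_sqrtr // dot_ge0. Qed.

Lemma enorm0 : enorm (0 : 'cV[R]_k) = 0.
Proof. by rewrite /enorm dot0r sqrtr0. Qed.

Lemma enorm_gt0 u : (0 < enorm u) = (u != 0).
Proof.
rewrite lt0r enorm_ge0 andbT -sqrf_eq0 sqr_enorm; congr (~~ _).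
by apply/eqP/eqP => [/dot_eq0//|->]; rewrite dot0r.
Qed.

Lemma enormZ a u : enorm (a *: u) = `|a| * enorm u.
Proof.
by rewrite /enorm dotZl dotZr mulrA -expr2 sqrtrM ?sqr_ge0 // sqrtr_sqr.
Qed.

Lemma cauchy_schwarz u v : `|dot u v| <= enorm u * enorm v.
Proof.
rewrite -ler_sqr ?nnegrE ?mulr_ge0 ?enorm_ge0 // exprMn !sqr_enorm.
rewrite real_normK ?num_real //.
have [->|v0] := eqVneq v 0; first by rewrite !dot0r mulr0 expr0n.
have vv_gt0 : 0 < dot v v by rewrite -sqr_enorm exprn_gt0 // enorm_gt0.
have := dot_ge0 (dot v v *: u - dot u v *: v).
rewrite !dotBl !dotBr !dotZl !dotZr (dotC v u) => h.
rewrite -subr_ge0 -(pmulr_rge0 _ vv_gt0).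
by apply: le_trans h _; rewrite le_eqVlt; apply/orP; left; apply/eqP; ring.
Qed.

Lemma enormD u v : enorm (u + v) <= enorm u + enorm v.
Proof.
rewrite -ler_sqr ?nnegrE ?addr_ge0 ?enorm_ge0 // sqrrD !sqr_enorm.
rewrite dotDl !dotDr (dotC v u).
by have := le_trans (ler_norm _) (cauchy_schwarz u v); lra.
Qed.

Lemma enorm_dist_triangle v u w :
  enorm (u - w) <= enorm (u - v) + enorm (v - w).
Proof. by rewrite -[u - w](subrKA v) enormD. Qed.

Lemma coord_le_enorm u i : `|u i 0| <= enorm u.
Proof.
rewrite -ler_sqr ?nnegrE ?enorm_ge0 // sqr_enorm real_normK ?num_real //.
rewrite dotE (bigD1 i) //= -expr2 lerDl.
by apply: sumr_ge0 => j _; rewrite -expr2 sqr_ge0.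
Qed.

End Euclidean.

Section SupNorm.
Variable R : realType.

Lemma coord_le_norm k (u : 'cV[R]_k) i : `|u i 0| <= `|u|.
Proof.
rewrite [leRHS]mx_normrE.
exact: (le_bigmax _ (fun ij : 'I_k * 'I_1 => `|u ij.1 ij.2|) (i, 0)).
Qed.

Lemma norm_le_coord k (u : 'cV[R]_k) a :
  0 <= a -> (forall i, `|u i 0| <= a) -> `|u| <= a.
Proof.
move=> a0 ua; rewrite [leLHS]mx_normrE.
by apply: bigmax_le => // -[i j] _ /=; rewrite ord1.
Qed.

Lemma norm_le_enorm k (u : 'cV[R]_k) : `|u| <= enorm u.
Proof. by apply: norm_le_coord; [exact: enorm_ge0|exact: coord_le_enorm]. Qed.

Lemma dot_le_norm k (u v : 'cV[R]_k) : `|dot u v| <= k%:R * `|u| * `|v|.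
Proof.
rewrite dotE; apply: le_trans (ler_norm_sum _ _ _) _.
have -> : k%:R * `|u| * `|v| = \sum_(i < k) `|u| * `|v|.
  by rewrite sumr_const card_ord -[RHS]mulr_natl mulrA.
by apply: ler_sum => i _; rewrite normrM ler_pM // coord_le_norm.
Qed.

Lemma enorm_le_norm k (u : 'cV[R]_k) : enorm u <= k%:R * `|u|.
Proof.
rewrite -ler_sqr ?nnegrE ?mulr_ge0 ?enorm_ge0 // sqr_enorm.
apply: le_trans (ler_norm _) (le_trans (dot_le_norm u u) _).
case: k u => [|k] u; first by rewrite !mul0r expr0n.
have k1 : 1 <= k.+1%:R :> R by rewrite ler1n.
rewrite exprMn !expr2 -[leLHS]mulrA ler_wpM2r ?mulr_ge0 //.
by rewrite ler_peMr // (le_trans ler01).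
Qed.

Lemma dot_mulmx k l (A : 'M[R]_(k, l)) u v : dot u (A *m v) = dot (A^T *m u) v.
Proof. by rewrite /dot trmx_mul trmxK mulmxA. Qed.

(** The sup norm of an integer vector is a natural number: this is what makes
   the norms of the best approximation vectors tend to infinity. *)
Lemma norm_Zvec_nat k (z : 'cV[int]_k) : exists N : nat, `|Zvec R z| = N%:R.
Proof.
have /natrP[N hN] : `|Zvec R z| \is a Num.nat.
  rewrite [X in X \is a _]mx_normrE.
  apply: (big_ind (fun x : R => x \is a Num.nat)) => [|x x' xN x'N|[i j] _].
  - exact: rpred0.
  - by rewrite /Num.max; case: ifP.
  - by rewrite /= mxE -intr_norm -abszE -pmulrn natr_nat.
by exists N.
Qed.

Lemma norm_Zvec_ge1 k (z : 'cV[int]_k) : z != 0 -> 1 <= `|Zvec R z|.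
Proof.
move=> z0; have [N hN] := norm_Zvec_nat z.
rewrite hN -[1]/(1%:R) ler_nat lt0n; apply: contra z0 => /eqP N0.
move: hN; rewrite N0 => /eqP; rewrite normr_eq0 => /eqP /matrixP h.
apply/eqP/matrixP => i j; have := h i j.
by rewrite !mxE => /eqP; rewrite intr_eq0 => /eqP.
Qed.

End SupNorm.

(** * Balls, hyperplanes and the game *)

Section Balls.
Variables (R : realType) (d : nat).
Hypothesis d_gt0 : (0 < d)%N.
Implicit Types (u v w x c : 'cV[R]_d) (b : 'cV[R]_d * R).

Lemma const1_neq0 : const_mx 1 != 0 :> 'cV[R]_d.
Proof.
apply/eqP => /matrixP /(_ (Ordinal d_gt0) 0) /eqP.
by rewrite !mxE oner_eq0.
Qed.

Lemma unit_direction v : exists2 u, enorm u = 1 & v = enorm v *: u.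
Proof.
have [v' v'0 v'E] : exists2 v', v' != 0 & v = (enorm v / enorm v') *: v'.
  have [->|v0] := eqVneq v 0.
    by exists (const_mx 1); rewrite ?const1_neq0 // enorm0 mul0r scale0r.
  by exists v => //; rewrite divff ?scale1r // gt_eqF // enorm_gt0.
have v'_gt0 : 0 < enorm v' by rewrite enorm_gt0.
exists ((enorm v')^-1 *: v'); last by rewrite scalerA.
by rewrite enormZ gtr0_norm ?invr_gt0 // mulVf ?gt_eqF.
Qed.

Lemma cball_subset b b' : 0 <= b'.2 -> cball b' `<=` cball b ->
  enorm (b'.1 - b.1) <= b.2 - b'.2.
Proof.
move=> r'0 sub; have [u u1 uE] := unit_direction (b'.1 - b.1).
have /sub : cball b' (b'.1 + b'.2 *: u).
  by rewrite /cball /= [b'.1 + _]addrC addrK enormZ u1 mulr1 ger0_norm.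
rewrite /cball /= addrAC uE -scalerDl !enormZ u1 !mulr1.
rewrite !ger0_norm ?addr_ge0 ?enorm_ge0 //; lra.
Qed.

Lemma subset_cball b b' : enorm (b'.1 - b.1) <= b.2 - b'.2 ->
  cball b' `<=` cball b.
Proof.
move=> le x; rewrite /cball /= => xb'.
by have := enorm_dist_triangle b'.1 x b.1; lra.
Qed.

Lemma nested_cballs (B : nat -> 'cV[R]_d * R) :
  (forall i, 0 < (B i).2) -> (forall i, cball (B i.+1) `<=` cball (B i)) ->
  exists c, forall i,
    cball (c, inf (range (fun j => (B j).2))) `<=` cball (B i).
Proof.
move=> r_gt0 sub; set r0 := inf _.
have r_lb : has_lbound (range (fun j => (B j).2)).
  by exists 0 => _ [j _ <-]; rewrite ltW.
have r0_le i : r0 <= (B i).2 by apply: ge_inf => //; exists i.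
have dist_le i l : enorm ((B (i + l)%N).1 - (B i).1) <= (B i).2 - (B (i + l)%N).2.
  elim: l => [|l IH]; first by rewrite addn0 !subrr enorm0.
  rewrite addnS; apply: le_trans (enorm_dist_triangle (B (i + l)%N).1 _ _) _.
  have := cball_subset (ltW (r_gt0 (i + l).+1)) (sub (i + l)%N); lra.
have r0_near e : 0 < e -> exists i, (B i).2 < r0 + e.
  move=> e0; have [|_ [i _ <-] lt] := @inf_adherent _ (range (fun j => (B j).2)) e e0.
    by split=> //; exists (B 0%N).2, 0%N.
  by exists i.
have /cauchy_cvgP /cvg_ex [c cB] : cauchy ((fun i => (B i).1) @ \oo).
  apply: cauchy_exP => e e0; have [i ri] := r0_near _ e0.
  exists (B i).1; exists i => // j /= ij.
  rewrite -ball_normE /= distrC.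
  apply: le_lt_trans (norm_le_enorm _) _.
  have := dist_le i (j - i)%N; rewrite subnKC // => h.
  by have := r0_le j; lra.
exists c => i; apply: subset_cball => /=.
apply/ler_addgt0Pr => e e0.
have e'0 : 0 < e / d%:R by rewrite divr_gt0 // ltr0n.
move/cvgrPdist_le: cB => /(_ _ e'0) [N _ hN].
have /= := hN (i + N)%N (leq_addl _ _) => hc.
apply: le_trans (enorm_dist_triangle (B (i + N)%N).1 _ _) _.
have := dist_le i N; have := r0_le (i + N)%N.
have := enorm_le_norm (c - (B (i + N)%N).1).
have : d%:R * `|c - (B (i + N)%N).1| <= e.
  by rewrite mulrC -ler_pdivlMr ?ltr0n.
lra.
Qed.

Lemma far_from_hyperplane w s e x : w != 0 ->
  (~ neighborhood [set x | dot x w = s] e x) <-> e * enorm w <= `|dot x w - s|.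
Proof.
move=> w0; have w_gt0 : 0 < enorm w by rewrite enorm_gt0.
split=> [far|le [h /= hs]]; last first.
  apply/negP; rewrite -leNgt -(ler_pM2r w_gt0) (le_trans le) //.
  by rewrite -hs -dotBl cauchy_schwarz.
rewrite leNgt; apply/negP => lt; apply: far.
set a := (dot x w - s) / enorm w ^+ 2.
(* The orthogonal projection of x onto the hyperplane. *)
exists (x - a *: w) => /=.
  rewrite dotBl dotZl /a -sqr_enorm divfK ?expf_neq0 ?gt_eqF //; lra.
rewrite subKr enormZ /a normrM normfV normrX (ger0_norm (enorm_ge0 w)).
by rewrite expr2 invfM mulrA divfK ?gt_eqF // ltr_pdivrMr.
Qed.

(** A neighbourhood of a hyperplane of half-width less than a third of the
   radius leaves room, on the side of the hyperplane where the centre lies, for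
   a ball of a third of the radius; this is where beta < 1/3 is used. *)
Lemma bob_can_answer (beta : R) b H e : 0 < beta < 3%:R^-1 -> 0 < b.2 ->
  hyperplane H -> 0 < e <= beta * b.2 ->
  exists b', [/\ cball b' `<=` cball b, cball b' `&` neighborhood H e = set0 &
    b'.2 = b.2 / 3%:R].
Proof.
move=> /andP[beta0 beta3] r0 [w [s [w0 ->]]] /andP[e0 eb].
have w_gt0 : 0 < enorm w by rewrite enorm_gt0.
pose sg : R := if s <= dot b.1 w then 1 else -1.
have sg1 : `|sg| = 1 by rewrite /sg; case: ifP; rewrite ?normrN1 ?normr1.
have sgE : 0 <= sg * (dot b.1 w - s).
  rewrite /sg; case: ifPn => h; first by rewrite mul1r subr_ge0.
  by rewrite mulN1r opprB subr_ge0 ltW // ltNge.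
have sgsg : sg * sg = 1 by rewrite /sg; case: ifP; rewrite ?mulrNN mulr1.
set t := b.2 / 3%:R.
exists (b.1 + (sg * (2 * t / enorm w)) *: w, t); split=> //.
  apply: subset_cball => /=.
  rewrite [b.1 + _]addrC addrK enormZ normrM sg1 mul1r ger0_norm; last first.
    by rewrite !divr_ge0 ?mulr_ge0 ?divr_ge0 // ltW.
  rewrite divfK ?gt_eqF // /t; lra.
rewrite -subset0 => x [xb']; apply: (far_from_hyperplane s e x w0).2.
have et : e * enorm w <= t * enorm w.
  rewrite ler_pM2r // (le_trans eb) // /t mulrC ler_pM2l // ltW //.
apply: le_trans et _.
move: xb'; rewrite /cball /=; set c := b.1 + _ => xc.
have := cauchy_schwarz (x - c) w.
have : enorm (x - c) * enorm w <= t * enorm w by rewrite ler_pM2r.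
have -> : `|dot x w - s| = `|sg * (dot x w - s)| by rewrite normrM sg1 mul1r.
have -> : dot (x - c) w = sg * (sg * dot (x - c) w) by rewrite mulrA sgsg mul1r.
rewrite normrM sg1 mul1r => h1 h2.
have : sg * dot c w = sg * dot b.1 w + 2 * t * enorm w.
  rewrite /c dotDl dotZl -(sqr_enorm w) mulrDr !mulrA sgsg mul1r.
  by rewrite divfK // gt_eqF.
move: h2; rewrite dotBl mulrBr ler_norml => /andP[h2 _] h3.
apply: le_trans (ler_norm _); move: sgE; rewrite !mulrBr; lra.
Qed.

End Balls.

Section Game.
Variables (R : realType) (d : nat).
Hypothesis d_gt0 : (0 < d)%N.
Variables (beta : R) (sigma : strategy R d).
Hypothesis beta_lt3 : 0 < beta < 3%:R^-1.
Hypothesis sigma_legal : legal_strategy beta sigma.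

Lemma bob_playsP (B : nat -> 'cV[R]_d * R) : bob_plays beta sigma B <->
  0 < (B 0%N).2 /\ forall i,
    [/\ cball (B i.+1) `<=` cball (B i),
        cball (B i.+1) `&` neighborhood (sigma (mkseq B i.+1)).1
          (sigma (mkseq B i.+1)).2 = set0 &
        beta * (B i).2 <= (B i.+1).2].
Proof.
by split=> -[B0 h]; split=> // i; move: (h i); case: (sigma _).
Qed.

Lemma bob_radius_gt0 (B : nat -> 'cV[R]_d * R) :
  bob_plays beta sigma B -> forall i, 0 < (B i).2.
Proof.
move=> /bob_playsP[B0 h]; elim=> // i IH.
have [_ _ /(lt_le_trans _)->//] := h i.
by case/andP: beta_lt3 => b0 _; rewrite mulr_gt0.
Qed.

Lemma shrinking_play b : 0 < b.2 -> exists B, [/\ B 0%N = b,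
  bob_plays beta sigma B & forall i, (B i).2 = b.2 / 3%:R ^+ i].
Proof.
move=> b0.
have [resp respP] : {resp : seq ('cV[R]_d * R) -> 'cV[R]_d * R |
    forall h x, 0 < x.2 -> let: (H, e) := sigma (rcons h x) in
    [/\ cball (resp (rcons h x)) `<=` cball x,
      cball (resp (rcons h x)) `&` neighborhood H e = set0 &
      (resp (rcons h x)).2 = x.2 / 3%:R]}.
  suff /choice[resp respP] : forall s : seq ('cV[R]_d * R), exists x',
      forall h x, s = rcons h x -> 0 < x.2 ->
      let: (H, e) := sigma s in
      [/\ cball x' `<=` cball x, cball x' `&` neighborhood H e = set0 &
        x'.2 = x.2 / 3%:R].
    by exists resp => h x; exact: respP.
  case/lastP => [|h x]; first by exists b => -[].
  have [x0|x0] := ltP 0 x.2; last first.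
    by exists b => h' x' /rcons_inj[_ <-]; rewrite ltNge x0.
  have [] := sigma_legal h x0; case: (sigma _) => H e /= HH eb.
  have [b' b'P] := bob_can_answer beta_lt3 x0 HH eb.
  by exists b' => h' x' /rcons_inj[_ <-].
pose hist := fix hist i := if i is i'.+1
  then rcons (hist i') (resp (hist i')) else [:: b].
pose B i := last b (hist i).
have histE i : mkseq B i.+1 = hist i.
  elim: i => [//|i IH]; rewrite mkseqS IH /=.
  by congr rcons; rewrite /B /= last_rcons.
have histS i : hist i = rcons (mkseq B i) (B i) by rewrite -histE mkseqS.
have BS i : B i.+1 = resp (hist i) by rewrite /B /= last_rcons.
have BP i : 0 < (B i).2 -> let: (H, e) := sigma (mkseq B i.+1) in
    [/\ cball (B i.+1) `<=` cball (B i),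
        cball (B i.+1) `&` neighborhood H e = set0 &
        (B i.+1).2 = (B i).2 / 3%:R].
  by move=> Bi; rewrite BS histE histS; exact: respP.
have rE i : 0 < (B i).2 /\ (B i).2 = b.2 / 3%:R ^+ i.
  elim: i => [|i [IH1 IH2]]; first by rewrite expr0 divr1.
  have := BP i IH1; case: (sigma _) => H e [_ _ ->].
  by rewrite divr_gt0 // IH2 exprSr invfM mulrA.
exists B; split=> // [|i]; last by case: (rE i).
split=> // i; have Bi := (rE i).1; have := BP i Bi.
case: (sigma _) => H e [? ? ->]; split=> //.
by case/andP: beta_lt3 => _ /ltW b3; rewrite mulrC ler_pM2l.
Qed.

(** Bob gains nothing by keeping his radii away from 0: the balls then meet in
   a ball of positive radius, from which a fresh play against the same strategy,
   with radii divided by 3 at each step, starts. *)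
Lemma win_shrinking_plays (S : set 'cV[R]_d) :
  (forall B, bob_plays beta sigma B ->
    (forall e : R, 0 < e -> exists i, (B i).2 < e) ->
    S `&` \bigcap_i cball (B i) !=set0) ->
  forall B, bob_plays beta sigma B -> S `&` \bigcap_i cball (B i) !=set0.
Proof.
move=> win B BP; have r_gt0 := bob_radius_gt0 BP.
have [_ Bi] := (bob_playsP B).1 BP.
have [c cB] := nested_cballs d_gt0 r_gt0 (fun i => let: And3 h _ _ := Bi i in h).
set r := inf _ in cB.
have r_lb : has_lbound (range (fun j => (B j).2)).
  by exists 0 => _ [j _ <-]; rewrite ltW.
have [r0|r0] := ltP 0 r; last first.
  apply: win => // e e0.
  have [|_ [i _ <-] lt] := @inf_adherent _ (range (fun j => (B j).2)) e e0.
    by split=> //; exists (B 0%N).2, 0%N.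
  by exists i; apply: lt_le_trans lt _; rewrite -/r; lra.
have [B' [B'0 B'P r'E]] := @shrinking_play (c, r) r0.
have [e e0|x [Sx xB']] := win B' B'P.
  exists (Num.bound (r / e)); rewrite r'E /= ltr_pdivrMr ?exprn_gt0 //.
  rewrite mulrC -ltr_pdivrMr // (lt_le_trans (archi_boundP _)) //.
    by rewrite divr_ge0 // ltW.
  by rewrite -natrX ler_nat ltnW // ltn_expl.
exists x; split=> // i _; apply: cB.
by have := xB' 0%N I; rewrite B'0.
Qed.

End Game.

(** * A game against a lacunary sequence of hyperplanes *)

Section LacunaryGame.
Variables (R : realType) (d : nat).
Hypothesis d_gt0 : (0 < d)%N.

Definition away_from_integers (w : nat -> 'cV[R]_d) (t : nat -> R) :
    set 'cV[R]_d :=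
  [set x | exists2 delta, 0 < delta &
    forall j (p : int), delta <= `|dot x (w j) - t j - p%:~R|].

Variables (beta lo hi : R) (w : nat -> 'cV[R]_d) (t : nat -> R).
Hypothesis beta_lt3 : 0 < beta < 3%:R^-1.
Hypothesis lo_gt0 : 0 < lo.
Hypothesis w_growth :
  forall j, lo * beta ^- j <= enorm (w j) <= hi * beta ^- j.

Let beta_gt0 : 0 < beta. Proof. by case/andP: beta_lt3. Qed.
Let beta_lt1 : beta < 1.
Proof. by case/andP: beta_lt3 => _ /lt_trans ->//; rewrite invf_lt1 ?ltr1n. Qed.
Let hi_gt0 : 0 < hi.
Proof.
have := w_growth 0%N; rewrite expr0 invr1 !mulr1 => /andP[h1 h2].
exact: lt_le_trans lo_gt0 (le_trans h1 h2).
Qed.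

(** Below the initial radius, so that no threshold is passed before the game starts,
   and so small that a ball whose radius is at most the j-th threshold is narrow
   compared with the gap between the hyperplanes of index j. *)
Let first_scale (r : R) := Num.min (r / 2) (4%:R * hi)^-1.

(** The thresholds first_scale rB * beta ^+ j form a geometric progression of ratio
   beta, so at most one of them lies in [r, r / beta). As a move of Bob divides
   the radius by at most 1 / beta, every threshold lies in this interval at some
   stage, provided that the radii tend to 0. *)
Let index (rB r : R) :=
  xget 0%N [set j | r <= first_scale rB * beta ^+ j < r / beta].

(** Alice avoids, among the parallel hyperplanes belonging to the current index,
   the one nearest to the centre of the ball; the ball is too small to come near
   any other. *)
Definition nearest_hyperplane_strategy : strategy R d := fun h =>
  let b := last (0, 0) h in
  let j := index (head (0, 0) h).2 b.2 in
  let p := Num.floor (dot b.1 (w j) - t j + 2^-1) in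
  ([set x | dot x (w j) = t j + p%:~R], beta * b.2).

Let w_neq0 j : w j != 0.
Proof.
rewrite -enorm_gt0; have /andP[/(lt_le_trans _)->//] := w_growth j.
by rewrite mulr_gt0 // invr_gt0 exprn_gt0.
Qed.

Let indexE rB r j : 0 < rB -> 0 < r ->
  r <= first_scale rB * beta ^+ j < r / beta -> index rB r = j.
Proof.
move=> rB0 r0 jP; rewrite /index; case: xgetP => [j' _ /= j'P|/(_ j)//].
have s_gt0 : 0 < first_scale rB.
  by rewrite lt_min divr_gt0 //= invr_gt0 mulr_gt0.
have impossible i i' : (i < i')%N -> r <= first_scale rB * beta ^+ i' ->
    first_scale rB * beta ^+ i < r / beta -> False.
  move=> ii' h1 h2; have bi_ge0 : 0 <= beta^-1 by rewrite invr_ge0 ltW.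
  have := lt_le_trans h2 (ler_wpM2r bi_ge0 h1).
  rewrite -mulrA ltr_pM2l //; apply/negP; rewrite -leNgt.
  by rewrite ler_pdivrMr // -exprSr ler_wiXn2l ?ltW.
case/andP: jP => j1 j2; case/andP: j'P => j'1 j'2.
by case: (ltngtP j j') => // [/impossible|/impossible] []//.
Qed.

(** For the j-th vector the play is examined at the first stage where the radius is
   at most the j-th threshold: the nearest hyperplane is avoided by Alice's move and
   the others are at least 1/2 - 1/4 away. *)
Lemma away_from_integers_win :
  exists2 sigma : strategy R d, legal_strategy beta sigma &
    forall B, bob_plays beta sigma B ->
      away_from_integers w t `&` \bigcap_i cball (B i) !=set0.
Proof.
have sigma_legal : legal_strategy beta nearest_hyperplane_strategy.
  move=> h b b0; rewrite /nearest_hyperplane_strategy last_rcons /=.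
  by split; [exists (w (index (head (0, 0) (rcons h b)).2 b.2)); eexists|
             rewrite lexx mulr_gt0].
exists nearest_hyperplane_strategy => //.
apply: (win_shrinking_plays d_gt0 beta_lt3 sigma_legal) => B BP r_to0.
have r_gt0 := bob_radius_gt0 beta_lt3 BP.
have [_ Bi] := (bob_playsP _ _ _).1 BP.
have [c cB] := nested_cballs d_gt0 r_gt0 (fun i => let: And3 h _ _ := Bi i in h).
have {}cB i : cball (B i) c.
  apply: cB; rewrite /cball /= subrr enorm0.
  by apply: lb_le_inf => [|_ [j _ <-]]; [exists (B 0%N).2, 0%N|rewrite ltW].
exists c; split=> [|i _]; last exact: cB.
set s := first_scale (B 0%N).2.
have s_gt0 : 0 < s by rewrite lt_min divr_gt0 //= invr_gt0 mulr_gt0.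
have s_lt : s < (B 0%N).2.
  by rewrite gt_min ltr_pdivrMr // ltr_pMr // ltr1n.
have s_hi : s * hi <= 4%:R^-1.
  by rewrite -ler_pdivlMr // -invfM ge_min lexx orbT.
exists (Num.min 4%:R^-1 (lo * beta ^+ 2 * s)) => [|j p].
  by rewrite lt_min invr_gt0 ltr0n /= !mulr_gt0 // exprn_gt0.
have bj_gt0 : 0 < beta ^+ j by rewrite exprn_gt0.
have hex : exists i, (B i).2 <= s * beta ^+ j.
  by have [|i /ltW] := r_to0 (s * beta ^+ j); [rewrite mulr_gt0|exists i].
have [i] : exists i, (B i).2 <= s * beta ^+ j < (B i).2 / beta.
  case: (ex_minnP hex) => -[|i] iP i_min.
    exfalso; move: iP; apply/negP; rewrite -ltNge; apply: le_lt_trans s_lt.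
    by rewrite ler_piMr ?(ltW s_gt0) // exprn_ile1 ?(ltW beta_gt0) ?(ltW beta_lt1).
  exists i.+1; rewrite iP /= ltr_pdivlMr // mulrC.
  have [_ _ /(lt_le_trans _)->//] := Bi i.
  rewrite ltr_pM2l // ltNge; apply/negP => /i_min.
  by rewrite ltnn.
move=> /[dup] ijP /andP[i1 i2].
have [_ disj _] := Bi i.
have far : ~ neighborhood (nearest_hyperplane_strategy (mkseq B i.+1)).1
    (nearest_hyperplane_strategy (mkseq B i.+1)).2 c.
  by move=> nc; have : set0 c by rewrite -disj; split=> //; exact: cB.
move: far; rewrite /nearest_hyperplane_strategy mkseqS last_rcons /=.
have -> : head (0, 0) (rcons (mkseq B i) (B i)) = B 0%N.
  by rewrite -mkseqS.
rewrite (indexE (r_gt0 0%N) (r_gt0 i) ijP).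
set p0 := Num.floor _ => /(far_from_hyperplane _ _ _ (w_neq0 j)) far.
have /andP[w1 w2] := w_growth j.
rewrite ge_min; have [->|pp0] := eqVneq p p0.
  apply/orP; right; rewrite -addrA -opprD (le_trans _ far) //.
  have -> : lo * beta ^+ 2 * s = beta * (s * beta ^+ j * beta) * (lo / beta ^+ j).
    by field; rewrite gt_eqF.
  rewrite ler_pM ?mulr_ge0 ?divr_ge0 ?(ltW s_gt0) ?(ltW bj_gt0)
    ?(ltW beta_gt0) ?(ltW lo_gt0) //.
    by rewrite invr_ge0 ltW.
  by rewrite ler_pM2l // -ler_pdivlMr // ltW.
apply/orP; left.
have wc : `|dot c (w j) - dot (B i).1 (w j)| <= 4%:R^-1.
  rewrite -dotBl; apply: le_trans (cauchy_schwarz _ _) _; apply: le_trans s_hi.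
  have -> : s * hi = (s * beta ^+ j) * (hi / beta ^+ j) by field; rewrite gt_eqF.
  by rewrite ler_pM ?enorm_ge0 // (le_trans (cB i)).
have pp : 1 <= `|p0%:~R - p%:~R : R|.
  rewrite -intrB -intr_norm -[1]/(1%:~R) ler_int.
  by rewrite -gtz0_ge1 normr_gt0 subr_eq0 eq_sym.
have := floor_itv (dot (B i).1 (w j) - t j + 2^-1).
rewrite -/p0 intrD => /andP[f1 f2].
move: wc pp; rewrite !ler_norml ler_normr => /andP[a1 a2].
rewrite ler_normr => /orP[h|h]; apply/orP; [left|right]; lra.
Qed.

End LacunaryGame.

(** * Transference *)

Section Transference.
Variable R : realType.

Lemma expr_unbounded (x lambda : R) : 1 < lambda -> exists N, x <= lambda ^+ N.
Proof.
move=> lambda1; have [x0|x0] := leP x 0.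
  by exists 0%N; rewrite expr0 (le_trans x0).
have l0 : 0 < lambda by rewrite (lt_trans ltr01).
have li : `|lambda^-1| < 1 by rewrite ger0_norm ?invr_ge0 ?ltW // invf_lt1.
have /cvgrPdist_le := cvg_geometric 1 li => /(_ x^-1).
rewrite invr_gt0 => /(_ x0) [N _ /(_ N (leqnn N))].
rewrite /= sub0r normrN mul1r exprVn ger0_norm ?invr_ge0 ?exprn_ge0 ?(ltW l0) //.
by rewrite lef_pV2 ?posrE ?exprn_gt0 // => h; exists N.
Qed.

Lemma le_distZ_affine k (v : 'cV[R]_k) (a b c : R) : 0 <= b ->
  (forall p, a <= b * `|v - Zvec R p| + c) -> a <= b * distZ v + c.
Proof.
move=> b0 le; have [b_eq0|b_neq0] := eqVneq b 0.
  by have := le 0; rewrite b_eq0 !mul0r.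
have b_gt0 : 0 < b by rewrite lt_neqAle eq_sym b_neq0.
rewrite -lerBlDr mulrC -ler_pdivrMr //.
apply: lb_le_inf => [|_ [p _ <-]]; first by exists `|v - Zvec R 0|, 0.
by rewrite ler_pdivrMr // lerBlDr mulrC.
Qed.

Lemma distZ_ge0 k (v : 'cV[R]_k) : 0 <= distZ v.
Proof.
by apply: lb_le_inf => [|_ [p _ <-]//]; exists `|v - Zvec R 0|, 0.
Qed.

Lemma distZ_le k (v : 'cV[R]_k) p : distZ v <= `|v - Zvec R p|.
Proof. by apply: ge_inf; [exists 0 => _ [p' _ <-]|exists p]. Qed.

Lemma dot_Zvec k (a b : 'cV[int]_k) :
  dot (Zvec R a) (Zvec R b) = (\sum_i a i 0 * b i 0)%:~R.
Proof.
rewrite dotE raddf_sum; apply: eq_bigr => i _.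
by rewrite !mxE /= intrM.
Qed.

(** The product of eta with z is, up to integers, minus the product of z with the
   error of approximation of eta by Theta q, plus the product of q with the error
   in Theta^T z. *)
Lemma transference n m (Theta : 'M[R]_(n, m)) (eta : 'cV[R]_n)
    (z : 'cV[int]_n) (q : 'cV[int]_m) (delta : R) :
  (forall p : int, delta <= `|dot eta (Zvec R z) - p%:~R|) ->
  delta <= n%:R * `|Zvec R z| * distZ (Theta *m Zvec R q - eta)
         + m%:R * `|Zvec R q| * distZ (Theta^T *m Zvec R z).
Proof.
move=> away; apply: le_distZ_affine => [|P]; first by rewrite mulr_ge0.
rewrite addrC; apply: le_distZ_affine => [|s]; first by rewrite mulr_ge0.
set e1 := _ - Zvec R P; set e2 := _ - Zvec R s.
apply: le_trans (away (\sum_i q i 0 * s i 0 - \sum_i P i 0 * z i 0)) _.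
rewrite intrB -!dot_Zvec.
have -> : dot eta (Zvec R z) - (dot (Zvec R q) (Zvec R s)
    - dot (Zvec R P) (Zvec R z)) = dot (Zvec R q) e2 - dot (Zvec R z) e1.
  rewrite /e1 /e2 !dotBr dot_mulmx trmxK (dotC (Zvec R z) (_ *m _)).
  by rewrite (dotC (Zvec R z) eta) (dotC (Zvec R z) (Zvec R P)); ring.
by apply: le_trans (ler_normB _ _) (lerD _ _); exact: dot_le_norm.
Qed.

Lemma BA_criterion n m (Theta : 'M[R]_(n, m)) (g : R -> R) (eta : 'cV[R]_n) c M :
  0 < c -> (forall q : 'cV[int]_m, M <= `|Zvec R q| ->
    c <= distZ (Theta *m Zvec R q - eta) ^+ n / g (`|Zvec R q| ^+ m)) ->
  BA Theta g eta.
Proof.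
move=> c0 cP; rewrite /BA /= limf_einfE.
apply: (@lt_le_trans _ _ c%:E); first by rewrite lte_fin.
apply: le_trans _ (ereal_sup_ubound _); last first.
  by exists ([set q | M <= `|q|] `&` range (@Zvec R m)) => //; exists M.
apply: le_ereal_inf_tmp; move=> _ [qR [Mq [q _ qE]] <-].
by rewrite -qE in Mq *; rewrite lee_fin cP.
Qed.

End Transference.

Section DirichletFunction.
Variables (R : realType) (f finv g : R -> R).
Hypothesis f_gt0 : forall T, 0 < T -> 0 < f T.
Hypothesis f_cont : {in `]0, +oo[, continuous f}.
Hypothesis f_decr : forall S T, 0 < S -> S < T -> f T < f S.
Hypothesis f_inv : forall T, 0 < T -> finv (f T) = T.
Hypothesis f_cvg0 : f T @[T --> +oo] --> 0.
Hypothesis gE : forall T, 0 < T -> g T = 1 / finv (1 / T).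
Hypothesis f_growth : exists2 gamma : R, 0 < gamma &
  \forall C \near +oo, forall T, 0 < T -> f (C * T) <= C `^ (- gamma) * f T.

(** Any factor e can be gained, by taking C with C ^ gamma >= 1 / e. *)
Lemma growth_arbitrary (e : R) : 0 < e ->
  exists2 C, 1 <= C & forall T, 0 < T -> f (C * T) <= e * f T.
Proof.
move=> e0; have [gamma gamma0 [M [_ hM]]] := f_growth.
set C := Num.max (M + 1) (Num.max 1 ((e^-1) `^ (gamma^-1))).
have C1 : 1 <= C by rewrite !le_max lexx orbT.
exists C => // T T0; apply: le_trans (hM C _ T T0) _.
  by rewrite lt_max ltrDl ltr01.
have Cg : e^-1 <= C `^ gamma.
  rewrite -[leLHS](@powRr1) ?invr_ge0 ?(ltW e0) // -(mulVf (lt0r_neq0 gamma0)).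
  rewrite powRrM ge0_ler_powR ?(ltW gamma0) ?nnegrE ?powR_ge0 ?(le_trans ler01) //.
  by rewrite !le_max lexx !orbT.
rewrite ler_pM2r ?f_gt0 // powRN -[leRHS]invrK lef_pV2 // posrE ?invr_gt0 //.
by rewrite powR_gt0 // (lt_le_trans ltr01).
Qed.

Lemma f_le S T : 0 < S -> S <= T -> f T <= f S.
Proof.
by move=> S0; rewrite le_eqVlt => /predU1P[->//|ST]; rewrite ltW ?f_decr.
Qed.

(** Large values are reached because the growth condition, at T = 1 / C, makes f
   unbounded near 0. *)
Lemma f_surjective (s : R) : 0 < s -> exists2 U, 0 < U & f U = s.
Proof.
move=> s0.
have [C C1 /(_ C^-1)hC] : exists2 C, 1 <= C &
    forall T, 0 < T -> f (C * T) <= f 1 / s * f T.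
  by apply: growth_arbitrary; rewrite divr_gt0 // f_gt0.
have C0 : 0 < C by rewrite (lt_le_trans ltr01).
have Ci0 : 0 < C^-1 by rewrite invr_gt0.
have sA : s <= f C^-1.
  have := hC Ci0; rewrite divff ?gt_eqF // mulrAC ler_pdivlMr // ler_pM2l //.
  exact: f_gt0.
have [B [CB fB]] : exists B, C^-1 <= B /\ f B <= s.
  move/cvgrPdist_le: f_cvg0 => /(_ _ s0)[M [_ hM]].
  exists (Num.max (M + 1) C^-1); split; first by rewrite le_max lexx orbT.
  have := hM (Num.max (M + 1) C^-1); rewrite sub0r normrN.
  rewrite lt_max ltrDl ltr01 => /(_ isT); exact: le_trans (ler_norm _).
have f_cont' : {within `[C^-1, B], continuous f}.
  apply: continuous_in_subspaceT => x; rewrite inE /= in_itv /= => /andP[xC _].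
  by apply: f_cont; rewrite in_itv /= andbT (lt_le_trans Ci0).
have fs : Num.min (f C^-1) (f B) <= s <= Num.max (f C^-1) (f B).
  by rewrite ge_min fB orbT le_max sA.
have [U UB fU] := IVT CB f_cont' fs.
exists U => //; move: UB; rewrite in_itv /= => /andP[+ _].
exact: lt_le_trans.
Qed.

(** For a given q, the scale used is the first one with (lambda ^+ k) ^+ n >= C * U,
   where f U = 1 / |q| ^ m. There the term with q in the transference inequality is at
   most delta / 2, and minimality bounds lambda ^+ k from above in terms of U. *)
Lemma BA_of_approximations n m (Theta : 'M[R]_(n, m)) (eta : 'cV[R]_n)
    (delta lambda : R) (k0 : nat) : (0 < m)%N -> (0 < n)%N ->
  0 < delta -> 1 < lambda ->
  (forall k, (k0 <= k)%N -> exists z : 'cV[int]_n,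
    [/\ `|Zvec R z| <= lambda ^+ k,
        distZ (Theta^T *m Zvec R z) ^+ m <= f ((lambda ^+ k) ^+ n) &
        forall p : int, delta <= `|dot eta (Zvec R z) - p%:~R|]) ->
  BA Theta g eta.
Proof.
move=> m_gt0 n_gt0 delta0 lambda1 approx.
have lambda0 : 0 < lambda by rewrite (lt_trans ltr01).
have m0 : 0 < m%:R :> R by rewrite ltr0n.
have n0 : 0 < n%:R :> R by rewrite ltr0n.
have [C C1 hC] : exists2 C, 1 <= C &
    forall T, 0 < T -> f (C * T) <= (delta / (2 * m%:R)) ^+ m * f T.
  by apply: growth_arbitrary; rewrite exprn_gt0 ?divr_gt0 ?mulr_gt0.
have C0 : 0 < C by rewrite (lt_le_trans ltr01).
pose U0 := (lambda ^+ k0) ^+ n.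
have U00 : 0 < U0 by rewrite !exprn_gt0.
pose c := (delta / (2 * n%:R)) ^+ n / (lambda ^+ n * C).
have c_gt0 : 0 < c.
  by rewrite divr_gt0 ?mulr_gt0 ?exprn_gt0 ?divr_gt0 ?mulr_gt0.
apply: (@BA_criterion _ _ _ _ _ _ c (1 + (f U0)^-1)) => // q hq.
have fU0 : 0 < f U0 by rewrite f_gt0.
have q1 : 1 <= `|Zvec R q|.
  by apply: le_trans hq; rewrite lerDl invr_ge0 ltW.
set T := `|Zvec R q| ^+ m.
have T_gt : (f U0)^-1 < T.
  apply: (@lt_le_trans _ _ `|Zvec R q|); last exact: ler_eXnr.
  by apply: lt_le_trans hq; rewrite ltrDr.
have T0 : 0 < T by rewrite (lt_trans _ T_gt) // invr_gt0.
have [U U_gt0 fU] : exists2 U, 0 < U & f U = 1 / T.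
  by apply: f_surjective; rewrite divr_gt0.
have gT : g T = U^-1 by rewrite gE // -fU f_inv // div1r.
have U0U : U0 < U.
  rewrite ltNge; apply/negP => /(f_le U_gt0); rewrite fU div1r leNgt => /negP.
  by apply; rewrite -[ltRHS]invrK ltf_pV2 // posrE // invr_gt0.
have scale_ex : exists l, C * U <= (lambda ^+ (k0 + l)) ^+ n.
  have [l hl] := expr_unbounded (C * U) lambda1; exists l.
  apply: le_trans hl _; rewrite -exprM ler_eXn2l //.
  by rewrite (leq_trans (leq_addl k0 l)) // leq_pmulr.
have [l lP l_min] := ex_minnP scale_ex.
case: l lP l_min => [|l] lP l_min.
  exfalso; move: lP; rewrite addn0 leNgt => /negP; apply.
  by apply: lt_le_trans U0U _; rewrite ler_peMl // ltW.
have {l_min}lP' : (lambda ^+ (k0 + l).+1) ^+ n < lambda ^+ n * C * U.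
  rewrite exprS exprMn -mulrA ltr_pM2l ?exprn_gt0 // ltNge.
  by apply/negP => /l_min; rewrite ltnn.
rewrite addnS in lP; set k := (k0 + l).+1 in lP lP'.
have [z [zk Dz zeta]] := approx k (leqW (leq_addr _ _)).
have := transference Theta q zeta.
set D := distZ _ in Dz *; set E := distZ _ => le.
have D0 : 0 <= D by exact: distZ_ge0.
have E0 : 0 <= E by exact: distZ_ge0.
have qD : m%:R * `|Zvec R q| * D <= delta / 2.
  rewrite -(@ler_pXn2r _ m) ?nnegrE ?mulr_ge0 ?divr_ge0 ?(ltW delta0) //.
  rewrite !exprMn -/T -ler_pdivlMl ?mulr_gt0 ?exprn_gt0 ?(lt_le_trans ltr01 q1) //.
  apply: le_trans Dz _; apply: le_trans (f_le _ lP) _; first by rewrite mulr_gt0.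
  apply: le_trans (hC U U_gt0) _; rewrite fU.
  rewrite le_eqVlt; apply/orP; left; apply/eqP.
  rewrite !exprMn !exprVn !exprMn; field.
  apply/and3P; split.
  - by rewrite expf_neq0 // pnatr_eq0.
  - by rewrite gt_eqF.
  - by rewrite expf_neq0 // gt_eqF.
have zE : delta / (2 * n%:R) <= lambda ^+ k * E.
  rewrite ler_pdivrMr ?mulr_gt0 //.
  have : n%:R * `|Zvec R z| * E <= n%:R * lambda ^+ k * E.
    by rewrite ler_wpM2r // ler_pM2l.
  have -> : lambda ^+ k * E * (2 * n%:R) = 2 * (n%:R * lambda ^+ k * E) by ring.
  by move: le qD; set a := _ * E; set b := _ * D; lra.
rewrite gT invrK /c ler_pdivrMr ?mulr_gt0 ?exprn_gt0 //.
apply: (@le_trans _ _ ((lambda ^+ k * E) ^+ n)).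
  by rewrite ler_pXn2r ?nnegrE ?mulr_ge0 ?divr_ge0 ?exprn_ge0 ?(ltW delta0) ?(ltW lambda0).
rewrite exprMn mulrC -mulrA ler_wpM2l ?exprn_ge0 //.
by rewrite [leRHS]mulrC ltW.
Qed.

End DirichletFunction.

(** * Orthonormal bases and asymptotic directions *)

Section Isometry.
Variables (R : realType) (n d : nat) (M : 'M[R]_(n, d)).
Hypothesis M_orthonormal : M^T *m M = 1%:M.

Lemma enorm_isometry x : enorm (M *m x) = enorm x.
Proof. by rewrite /enorm dot_mulmx mulmxA M_orthonormal mul1mx. Qed.

Lemma enorm_trmx_le u : enorm (M^T *m u) <= enorm u.
Proof.
have [->|Mu0] := eqVneq (M^T *m u) 0; first by rewrite enorm0 enorm_ge0.
have Mu_gt0 : 0 < enorm (M^T *m u) by rewrite enorm_gt0.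
rewrite -(ler_pM2l Mu_gt0) -expr2 sqr_enorm -dot_mulmx dotC.
rewrite -[X in X * _]enorm_isometry.
exact: le_trans (ler_norm _) (cauchy_schwarz _ _).
Qed.

End Isometry.

Section OrthonormalBasis.
Variables (R : realType) (n : nat).

Lemma mem_affine_subspace (a x : 'cV[R]_n) (L : {vspace 'cV[R]_n}) :
  affine_subspace a L x <-> x - a \in L.
Proof.
split=> [[u uL <-]|xL]; first by rewrite addrC addKr.
by exists (x - a) => //; rewrite addrC subrK.
Qed.

(** Gram-Schmidt: a unit vector e of L splits off, and induction applies to the part
   of L orthogonal to e, the intersection of L with the kernel of the product with
   e. *)
Lemma orthonormal_basis d (L : {vspace 'cV[R]_n}) : \dim L = d ->
  exists M : 'M[R]_(n, d),
    M^T *m M = 1%:M /\ forall u, u \in L <-> exists x, u = M *m x.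
Proof.
elim: d L => [|d IH] L dimL.
  exists 0; split=> [|u]; first by rewrite [LHS]flatmx0 [RHS]flatmx0.
  have /eqP -> : L == 0%VS by rewrite -dimv_eq0 dimL.
  by rewrite memv0; split=> [/eqP->|[x ->]]; [exists 0|]; rewrite mul0mx.
have v0 : vpick L != 0 by rewrite vpick0 -dimv_eq0 dimL.
pose e := (enorm (vpick L))^-1 *: vpick L.
have eL : e \in L by rewrite memvZ // memv_pick.
have ee : dot e e = 1.
  by rewrite -sqr_enorm enormZ ger0_norm ?invr_ge0 ?enorm_ge0 // mulVf ?expr1n //
     gt_eqF // enorm_gt0.
pose phi := linfun (mulmx e^T : 'cV[R]_n -> 'M[R]_1).
have phiE u : (phi u == 0) = (dot e u == 0).
  rewrite lfunE /=; apply/eqP/eqP => [h|h]; first by rewrite /dot h mxE.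
  by apply/matrixP => i j; rewrite !ord1 [LHS]h mxE.
have dim_phi : \dim (phi @: L) = 1%N.
  apply/eqP; rewrite eqn_leq lt0n dimv_eq0; apply/andP; split.
    by rewrite (leq_trans (dimvS (subvf _))) // dimvf /dim /= muln1.
  apply/eqP => phi0; have : phi e \in (phi @: L)%VS by rewrite memv_img.
  by rewrite phi0 memv0 phiE ee oner_eq0.
have [|M' [M'M' M'L]] := IH (L :&: lker phi)%VS.
  by have := limg_ker_dim phi L; rewrite dim_phi dimL addn1 => -[].
have eM' x : dot e (M' *m x) = 0.
  have : M' *m x \in (L :&: lker phi)%VS by apply/M'L; exists x.
  by rewrite memv_cap memv_ker phiE => /andP[_ /eqP].
have eTM' : e^T *m M' = 0.
  apply: trmx_inj; rewrite trmx0; apply: dot_eq0.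
  by rewrite /dot trmxK -mulmxA; exact: eM'.
exists (row_mx e M' : 'M[R]_(n, 1 + d)); split=> [|u].
  change ((row_mx e M')^T *m row_mx e M' = 1%:M :> 'M[R]_(1 + d)%N).
  rewrite tr_row_mx mul_col_row eTM' M'M' -[M'^T *m e]trmxK trmx_mul trmxK eTM'.
  rewrite trmx0 (@scalar_mx_block _ 1 d); congr block_mx.
  by apply/matrixP => i j; rewrite !ord1 [LHS]ee !mxE eqxx.
split=> [uL|[x ->]].
  have /M'L[x' x'E] : u - dot e u *: e \in (L :&: lker phi)%VS.
    rewrite memv_cap; apply/andP; split; first by apply: memvB => //; exact: memvZ.
    by rewrite memv_ker phiE dotBr dotZr ee mulr1 subrr.
  exists (col_mx (dot e u)%:M x').
  by rewrite (@mul_row_col _ n 1 d 1) mul_mx_scalar -x'E addrC subrK.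
rewrite -[x](@vsubmxK _ 1 d 1) (@mul_row_col _ n 1 d 1) memvD //.
  rewrite [usubmx _](_ : _ = (usubmx (x : 'cV[R]_(1 + d)) 0 0)%:M).
    by rewrite mul_mx_scalar memvZ.
  by apply/matrixP => i j; rewrite !ord1 [RHS]mxE eqxx mulr1n.
have : M' *m dsubmx (x : 'cV[R]_(1 + d)) \in (L :&: lker phi)%VS.
  by apply/M'L; eexists.
by rewrite memv_cap => /andP[].
Qed.

End OrthonormalBasis.

Section AsymptoticDirections.
Variables (R : realType) (n : nat).

Lemma bounded_cluster (u : nat -> 'cV[R]_n) (b : R) :
  (forall i, `|u i| <= b) ->
  exists v, forall (e : R) N, 0 < e -> exists2 i, (N <= i)%N & `|v - u i| < e.
Proof.
move=> ub; have tr_ball (w v : 'cV[R]_n) e : ball w^T e v^T -> ball w e v.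
  by case=> e0 h; split=> // i j; have := h j i; rewrite !mxE.
pose K := [set w : 'rV[R]_n | forall i, `[- b, b]%classic (w ord0 i)].
have K_compact : compact K.
  by apply: (@rV_compact _ _ (fun=> `[- b, b]%classic)) => i; exact: segment_compact.
have uK : ((fun i => (u i)^T) @ \oo) K.
  exists 0%N => // i _ j /=; rewrite mxE in_itv /= -ler_norml.
  exact: le_trans (coord_le_norm _ _) (ub i).
have [w [_ cl]] := K_compact _ _ uK.
exists w^T => e N e0.
have uN : ((fun i => (u i)^T) @ \oo) [set (u i)^T | i in [set i | (N <= i)%N]].
  by exists N => // i Ni; exists i.
have [_ [[i Ni <-] wi]] := cl _ _ uN (nbhsx_ballx w _ e0).
exists i => //; have : ball w^T e (u i) by apply: tr_ball; rewrite trmxK.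
by rewrite -ball_normE.
Qed.

Lemma subsequence_cvg (u : nat -> 'cV[R]_n) v :
  (forall (e : R) N, 0 < e -> exists2 i, (N <= i)%N & `|v - u i| < e) ->
  exists2 k : nat -> nat, (forall i j, (i < j)%N -> (k i < k j)%N) &
    u (k j) @[j --> \oo] --> v.
Proof.
move=> cl; have /choice[F FP] : forall Nj : nat * nat, exists i,
    (Nj.1 <= i)%N /\ `|v - u i| < Nj.2.+1%:R^-1.
  by move=> [N j]; have [|i] := cl j.+1%:R^-1 N; [rewrite invr_gt0|exists i].
pose k := fix k j := if j is j'.+1 then F ((k j').+1, j) else F (0%N, 0%N).
exists k => [i j|].
  apply: (homo_ltn (r := fun a b => (a < b)%N)) => [? ? ?|]; first exact: ltn_trans.
  by move=> {}i; have [] := FP ((k i).+1, i.+1).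
have kP j : `|v - u (k j)| < j.+1%:R^-1.
  by case: j => [|j]; [have [] := FP (0%N, 0%N)|have [] := FP ((k j).+1, j.+1)].
apply/cvgrPdist_lt => e e0; near=> j; apply: lt_trans (kP j) _.
by near: j; exact: near_infty_natSinv_lt (PosNum e0).
Unshelve. all: by end_near. Qed.

(** By compactness of the sphere, if the projections to L of infinitely many of
   the y_nu were small relative to y_nu, some asymptotic direction would be
   orthogonal to L. *)
Lemma projection_lower_bound m (Phi : 'M[R]_(m, n)) (y : nat -> 'cV[int]_n)
    d (M : 'M[R]_(n, d)) (L : {vspace 'cV[R]_n}) :
  M^T *m M = 1%:M -> (forall u, u \in L -> exists x, u = M *m x) ->
  ~ trivially_singular Phi -> (forall i, y i != 0) ->
  orthogonal_complement L `&` asymptotic_directions Phi y = set0 ->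
  exists (c : R) N, 0 < c /\ forall i, (N <= i)%N ->
    c * enorm (Zvec R (y i)) <= enorm (M^T *m Zvec R (y i)).
Proof.
move=> MM LM nsing y0 disj; apply: contrapT => no_bound.
pose u i := (enorm (Zvec R (y i)))^-1 *: Zvec R (y i).
have y_gt0 i : 0 < enorm (Zvec R (y i)).
  apply: lt_le_trans (norm_le_enorm _).
  exact: lt_le_trans ltr01 (norm_Zvec_ge1 R (y0 i)).
have u1 i : enorm (u i) = 1.
  by rewrite enormZ gtr0_norm ?invr_gt0 // mulVf // gt_eqF.
have /choice[h hP] : forall j, exists i, (j <= i)%N /\
    enorm (M^T *m u i) < j.+1%:R^-1.
  move=> j; apply: contrapT => no_i; apply: no_bound.
  exists j.+1%:R^-1, j; split=> [|i ji]; first by rewrite invr_gt0.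
  rewrite -ler_pdivlMr // leNgt; apply/negP => lt; apply: no_i; exists i; split=> //.
  by rewrite /u -scalemxAr enormZ gtr0_norm ?invr_gt0 // mulrC.
have [v vP] : exists v, forall (e : R) N, 0 < e ->
    exists2 i, (N <= i)%N & `|v - u (h i)| < e.
  by apply: (@bounded_cluster _ 1) => i; rewrite -(u1 (h i)) norm_le_enorm.
have Mv : M^T *m v = 0.
  apply/eqP; rewrite -[_ == _]negbK -enorm_gt0 -leNgt.
  apply/ler_addgt0Pr => e e0; rewrite add0r.
  have e2 : 0 < e / 2 by rewrite divr_gt0.
  have [N _ hN] := near_infty_natSinv_lt (PosNum e2).
  have n1 : 0 < n.+1%:R :> R by rewrite ltr0n.
  have [|i Ni vi] := vP (e / 2 / n.+1%:R) N; first by rewrite divr_gt0.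
  have /= h1 := hN i Ni; have [_ h2] := hP i.
  rewrite -[v](subrK (u (h i))) mulmxDr.
  apply: le_trans (enormD _ _) _; rewrite [leRHS]splitr.
  apply: lerD; last exact: ltW (lt_trans h2 h1).
  apply: le_trans (enorm_trmx_le MM _) (le_trans (enorm_le_norm _) _).
  apply: le_trans (_ : n.+1%:R * `|v - u (h i)| <= _).
    by rewrite ler_wpM2r // ler_nat.
  by move: vi; rewrite ltr_pdivlMr // mulrC => /ltW.
suff : set0 v by [].
rewrite -disj; split.
  by move=> _ /LM[x ->]; rewrite dotC dot_mulmx Mv dotC dot0r.
split=> //.
have [|k k_incr kv] := @subsequence_cvg u v.
  move=> e N e0; have [i Ni vi] := vP e N e0; exists (h i) => //.
  by have [hi _] := hP i; exact: leq_trans hi.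
exists k, (fun=> false); split=> //.
by under eq_fun do rewrite expr0 scale1r.
Qed.

End AsymptoticDirections.

(** * Best approximations *)

Section BestApproximations.
Variables (R : realType) (a b : nat) (Phi : 'M[R]_(a, b)).
Variable y : nat -> 'cV[int]_b.
Hypothesis y_best : best_approximations Phi y.

Let N i : R := `|Zvec R (y i)|.

Lemma best_norm_mono i j : (i <= j)%N -> N i <= N j.
Proof.
have [_ incr _ _] := y_best.
by apply: (homo_leq (r := fun s t => s <= t)) => // [? ? ?|k]; [exact: le_trans|exact: ltW (incr k)].
Qed.

Lemma best_norm_lt i j : (N i < N j) -> (i < j)%N.
Proof. by rewrite ltnNge ltNge; apply: contra; exact: best_norm_mono. Qed.

Lemma best_norm_ge1 i : 1 <= N i.
Proof. by have [y0 _ _ _] := y_best; rewrite -y0 best_norm_mono. Qed.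

Lemma best_neq0 i : y i != 0.
Proof.
apply/eqP => yi0; have := best_norm_ge1 i.
rewrite /N yi0 (_ : Zvec R 0 = 0) ?normr0 ?ler10 //.
by apply/matrixP => ? ?; rewrite !mxE.
Qed.

Lemma best_norm_ge i : i%:R <= N i.
Proof.
have [_ incr _ _] := y_best.
elim: i => [|i IH]; first by rewrite (le_trans ler01) ?best_norm_ge1.
have := incr i; rewrite -/(N i) -/(N i.+1).
have [k kE] := norm_Zvec_nat R (y i); have [l lE] := norm_Zvec_nat R (y i.+1).
move: IH; rewrite /N kE lE ler_nat ltr_nat => ik kl.
by rewrite ler_nat (leq_ltn_trans ik).
Qed.

Lemma best_between (t : R) : 1 <= t -> exists i, N i <= t < N i.+1.
Proof.
move=> t1; have ex : exists i, t < N i.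
  exists (Num.bound t); apply: lt_le_trans (best_norm_ge _).
  by rewrite archi_boundP // (le_trans ler01).
case: (ex_minnP ex) => -[|i] ti imin.
  by have [y0 _ _ _] := y_best; move: ti; rewrite /N y0 ltNge t1.
exists i; rewrite ti andbT leNgt; apply/negP => /imin.
by rewrite ltnn.
Qed.

(** The minimality in the definition of psi turns the vector given by the Dirichlet
   property into a bound for the best approximation. *)
Lemma best_dirichlet (f : R -> R) : (0 < b)%N -> dirichlet f Phi ->
  exists T0 : R, forall i t, T0 <= t -> N i <= t < N i.+1 ->
    distZ (Phi *m Zvec R (y i)) ^+ a <= f (t ^+ b).
Proof.
move=> b_gt0 [T [_ hT]]; have [_ _ best _] := y_best.
exists (Num.max 1 (T + 1)) => i t; rewrite ge_max => /andP[t1 tT] it.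
have [|x [x0 xf xt]] := hT (t ^+ b).
  by apply: lt_le_trans (ler_eXnr b_gt0 t1); apply: lt_le_trans tT; rewrite ltrDl.
apply: le_trans xf; rewrite -(best i t it).
have lb : has_lbound [set distZ (Phi *m Zvec R z) |
    z in [set z : 'cV[int]_b | 0 < `|Zvec R z| <= t]].
  by exists 0 => _ [z _ <-]; exact: distZ_ge0.
rewrite lerXn2r ?nnegrE ?distZ_ge0 //.
  apply: lb_le_inf => [|_ [z _ <-]]; last exact: distZ_ge0.
  by exists (distZ (Phi *m Zvec R (y i))), (y i) => //=;
    case/andP: it => -> _; rewrite (lt_le_trans ltr01) ?best_norm_ge1.
apply: ge_inf => //; exists x => //=.
rewrite (lt_le_trans ltr01) ?norm_Zvec_ge1 //=.
by rewrite -(@ler_pXn2r _ b) // nnegrE // (le_trans ler01).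
Qed.

End BestApproximations.

Section Main.
Variables (R : realType) (m n : nat) (f finv g : R -> R) (Theta : 'M[R]_(n, m)).
Hypothesis m_gt0 : (0 < m)%N.
Hypothesis n_gt0 : (0 < n)%N.
Hypothesis f_gt0 : forall T, 0 < T -> 0 < f T.
Hypothesis f_cont : {in `]0, +oo[, continuous f}.
Hypothesis f_decr : forall S T, 0 < S -> S < T -> f T < f S.
Hypothesis f_inv : forall T, 0 < T -> finv (f T) = T.
Hypothesis f_cvg0 : f T @[T --> +oo] --> 0.
Hypothesis gE : forall T, 0 < T -> g T = 1 / finv (1 / T).
Hypothesis f_growth : exists2 gamma : R, 0 < gamma &
  \forall C \near +oo, forall T, 0 < T -> f (C * T) <= C `^ (- gamma) * f T.
Hypothesis Theta_dirichlet : dirichlet f Theta^T.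

Variables (d : nat) (M : 'M[R]_(n, d)) (a : 'cV[R]_n).
Hypothesis d_gt0 : (0 < d)%N.
Hypothesis MM : M^T *m M = 1%:M.

Let phi (x : 'cV[R]_d) := a + M *m x.

Let dot_phi x z : dot (phi x) z = dot x (M^T *m z) - (- dot a z).
Proof. by rewrite /phi dotDl (dotC (M *m x)) dot_mulmx (dotC x) opprK addrC. Qed.

Lemma HAW_of_away_from_integers (S : set 'cV[R]_d) :
  (forall beta : R, 0 < beta < 3%:R^-1 -> exists (lo hi : R) w t, [/\ 0 < lo,
     forall j : nat, lo * beta ^- j <= enorm (w j) <= hi * beta ^- j &
     away_from_integers w t `<=` S]) ->
  HAW S.
Proof.
move=> sub beta beta3; have [lo [hi [w [t [lo0 wP wS]]]]] := sub beta beta3.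
have [sigma legal win] := away_from_integers_win d_gt0 t beta3 lo0 wP.
by exists sigma => // B /win[x [/wS Sx xB]]; exists x.
Qed.

Lemma BA_of_singular (z : 'cV[int]_n) (p : 'cV[int]_m) (eta : 'cV[R]_n) (delta : R) :
  Theta^T *m Zvec R z = Zvec R p -> 0 < delta ->
  (forall s : int, delta <= `|dot eta (Zvec R z) - s%:~R|) -> BA Theta g eta.
Proof.
move=> zp delta0 away; have two_gt1 : 1 < 2 :> R by rewrite ltr1n.
have [k0 hk0] := expr_unbounded `|Zvec R z| two_gt1.
have dist0 : distZ (Theta^T *m Zvec R z) = 0.
  apply/eqP; rewrite eq_le distZ_ge0 andbT.
  by apply: le_trans (distZ_le _ p) _; rewrite zp subrr normr0.
apply: (BA_of_approximations f_gt0 f_cont f_decr f_inv f_cvg0 gE f_growth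
  (k0 := k0) m_gt0 n_gt0 delta0 two_gt1) => k k0k.
exists z; split=> //; first by rewrite (le_trans hk0) // ler_eXn2l.
by rewrite dist0 expr0n gtn_eqF // ltW // f_gt0 // !exprn_gt0.
Qed.

Lemma HAW_singular (z : 'cV[int]_n) (p : 'cV[int]_m) :
  Theta^T *m Zvec R z = Zvec R p ->
  M^T *m Zvec R z != 0 \/ (forall s : int, dot a (Zvec R z) != s%:~R) ->
  HAW (phi @^-1` BA Theta g).
Proof.
move=> zp zP; have [Mz0|Mz0] := eqVneq (M^T *m Zvec R z) 0.
  (* The whole subspace lies in the set; the vectors of the game are arbitrary. *)
  apply: HAW_of_away_from_integers => beta /andP[beta0 _].
  have [e e1 _] := unit_direction d_gt0 (0 : 'cV[R]_d).
  exists 1, 1, (fun j : nat => beta ^- j *: e), (fun=> 0); split=> // [j|x _].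
    by rewrite enormZ e1 mulr1 mul1r ger0_norm ?lexx // invr_ge0 exprn_ge0 // ltW.
  set b := dot a (Zvec R z) in zP.
  have bP : forall s : int, b != s%:~R by case: zP => //; rewrite Mz0 eqxx.
  have /andP[b1 b2] := floor_itv b; set s0 := Num.floor b in b1 b2.
  have b1' : s0%:~R < b by rewrite lt_neqAle b1 eq_sym bP.
  apply: (BA_of_singular (delta := Num.min (b - s0%:~R) ((s0 + 1)%:~R - b)) zp).
    by rewrite lt_min !subr_gt0 b1'.
  move=> s; rewrite dot_phi Mz0 dot0r sub0r opprK -/b ge_min.
  have [s0s|ss0] := leP s s0.
    have : s%:~R <= s0%:~R :> R by rewrite ler_int.
    by rewrite ler_normr => h; apply/orP; left; apply/orP; left; lra.
  have : (s0 + 1)%:~R <= s%:~R :> R by rewrite ler_int lezD1.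
  by rewrite !ler_normr => h; apply/orP; right; apply/orP; right; lra.
apply: HAW_of_away_from_integers => beta /andP[beta0 _].
set w := M^T *m _ in Mz0 *.
exists (enorm w), (enorm w), (fun j : nat => beta ^- j *: w), (fun=> - dot a (Zvec R z)).
split=> [|j|x [delta delta0 away]]; first by rewrite enorm_gt0.
  by rewrite enormZ ger0_norm ?invr_ge0 ?exprn_ge0 ?(ltW beta0) // mulrC lexx.
apply: (BA_of_singular zp delta0) => s.
by have := away 0%N s; rewrite expr0 invr1 scale1r dot_phi.
Qed.

Variable y : nat -> 'cV[int]_n.
Hypothesis y_best : best_approximations Theta^T y.
Variables (c : R) (N : nat).
Hypothesis c_gt0 : 0 < c.
Hypothesis My_ge : forall i, (N <= i)%N ->
  c * enorm (Zvec R (y i)) <= enorm (M^T *m Zvec R (y i)).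

(** Of the best approximations with norm in a block between successive powers of
   lambda, only the last is used, and only if the next norm exceeds the block: this
   gives the lacunarity required by the game. For t a large power of lambda, the last
   best approximation of norm at most t is still among the vectors used. *)
Let last_in_block (lambda : R) (j i : nat) :=
  lambda ^+ j < `|Zvec R (y i)| /\
  `|Zvec R (y i)| <= lambda ^+ j.+1 < `|Zvec R (y i.+1)|.

Let last_in_block_inj lambda j i i' :
  last_in_block lambda j i -> last_in_block lambda j i' -> i = i'.
Proof.
suff lt k k' : last_in_block lambda j k -> last_in_block lambda j k' -> (k <= k')%N.
  by move=> h h'; apply/eqP; rewrite eqn_leq !lt.
move=> [_ /andP[k1 _]] [_ /andP[_ k2]].
by rewrite -ltnS; apply: (best_norm_lt y_best); exact: le_lt_trans k1 k2.
Qed.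

Lemma HAW_nonsingular : HAW (phi @^-1` BA Theta g).
Proof.
apply: HAW_of_away_from_integers => beta /andP[beta0 beta3].
pose lambda := beta^-1.
have lambda1 : 1 < lambda.
  by rewrite invf_gt1 // (lt_trans beta3) // invf_lt1 ?ltr1n.
have lambda0 : 0 < lambda by rewrite invr_gt0.
have pow_gt0 j : 0 < lambda ^+ j by rewrite exprn_gt0.
have [j0 hj0] := expr_unbounded `|Zvec R (y N)| lambda1.
have [e e1 _] := unit_direction d_gt0 (0 : 'cV[R]_d).
pose lo := Num.min (c * lambda ^+ j0) 1.
pose hi := Num.max (n%:R * lambda ^+ j0.+1) 1.
(* A multiple of a fixed unit vector e fills the blocks that provide no vector. *)
have /choice[wt wtP] : forall j, exists wt : 'cV[R]_d * R,
    lo * lambda ^+ j <= enorm wt.1 <= hi * lambda ^+ j /\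
    forall i, last_in_block lambda (j0 + j) i ->
      wt = (M^T *m Zvec R (y i), - dot a (Zvec R (y i))).
  move=> j; have [[i iP]|no_i] := EM (exists i, last_in_block lambda (j0 + j) i).
    exists (M^T *m Zvec R (y i), - dot a (Zvec R (y i))); split=> [|i' i'P]; last first.
      by rewrite (last_in_block_inj iP i'P).
    have [i1 /andP[i2 _]] := iP; apply/andP; split=> /=.
      have Ni : (N <= i)%N.
        apply: ltnW; apply: (best_norm_lt y_best); apply: le_lt_trans i1.
        by apply: le_trans hj0 _; rewrite ler_eXn2l // leq_addr.
      apply: le_trans (My_ge Ni).
      apply: (@le_trans _ _ (c * lambda ^+ j0 * lambda ^+ j)).
        by rewrite ler_pM2r // ge_min lexx.
      rewrite -mulrA -exprD ler_pM2l // ltW //.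
      exact: lt_le_trans i1 (norm_le_enorm _).
    apply: le_trans (enorm_trmx_le MM _) (le_trans (enorm_le_norm _) _).
    apply: (@le_trans _ _ (n%:R * lambda ^+ j0.+1 * lambda ^+ j)).
      by rewrite -mulrA -exprD addSn ler_wpM2l.
    by rewrite ler_pM2r // le_max lexx.
  exists (lambda ^+ j *: e, 0); split=> [|i iP]; last by case: no_i; exists i.
  rewrite /= enormZ e1 mulr1 gtr0_norm // ler_piMl ?ler_peMl ?(ltW (pow_gt0 j)) //.
    by rewrite le_max lexx orbT.
  by rewrite ge_min lexx orbT.
exists lo, hi, (fun j => (wt j).1), (fun j => (wt j).2); split=> [|j|x].
- by rewrite lt_min mulr_gt0 ?ltr01.
- by rewrite -exprVn; have [] := wtP j.
move=> [delta delta0 away].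
have [T0 hT0] := best_dirichlet y_best n_gt0 Theta_dirichlet.
pose N1 := Num.bound (lambda ^+ j0).
have yN1 : lambda ^+ j0 < `|Zvec R (y N1)|.
  apply: lt_le_trans (best_norm_ge y_best N1).
  by rewrite archi_boundP // ltW.
have [k0 hk0] := expr_unbounded (Num.max T0 `|Zvec R (y N1)|) lambda1.
apply: (BA_of_approximations f_gt0 f_cont f_decr f_inv f_cvg0 gE f_growth
  (k0 := k0) m_gt0 n_gt0 delta0 lambda1) => k k0k.
have : Num.max T0 `|Zvec R (y N1)| <= lambda ^+ k.
  by apply: le_trans hk0 _; rewrite ler_eXn2l.
rewrite ge_max => /andP[T0k N1k].
have [|i iP] := best_between y_best (t := lambda ^+ k).
  by rewrite exprn_ege1 // ltW.
exists (y i); have /andP[ik ki] := iP; split=> //; first exact: hT0.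
have yi : lambda ^+ j0 < `|Zvec R (y i)|.
  apply: lt_le_trans yN1 (best_norm_mono y_best _); rewrite -ltnS.
  by apply: (best_norm_lt y_best); exact: le_lt_trans ki.
have j0k : (j0 < k)%N.
  by rewrite -(ltr_eXn2l lambda1) (lt_le_trans yi).
have [j jP] : exists j, last_in_block lambda (j0 + j) i.
  have ex : exists l, `|Zvec R (y i)| <= lambda ^+ (j0 + l).
    by exists (k - j0)%N; rewrite subnKC // ltnW.
  case: (ex_minnP ex) => -[|j] jP jmin.
    by move: yi; rewrite ltNge -[j0]addn0 jP.
  exists j; split; first by rewrite ltNge; apply/negP => /jmin; rewrite ltnn.
  rewrite -addnS jP /=; apply: le_lt_trans ki; rewrite ler_eXn2l //.
  by rewrite -leq_subRL ?(ltnW j0k) // jmin // subnKC // ltnW.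
move=> s; have := away j s; have [_ /(_ i jP) ->] := wtP j.
by rewrite dot_phi.
Qed.

End Main.

(** * The theorem *)

Theorem theorem3p4 (R : realType) (m n : nat) (hm : (0 < m)%N) (hn : (0 < n)%N)
  (f finv g : R -> R)
  (f_gt0 : forall T, 0 < T -> 0 < f T)
  (f_cont : {in `]0, +oo[, continuous f})
  (f_decr : forall S T, 0 < S -> S < T -> f T < f S)
  (f_inv : forall T, 0 < T -> finv (f T) = T)
  (f_cvg0 : f T @[T --> +oo] --> 0)
  (gE : forall T, 0 < T -> g T = 1 / finv (1 / T))
  (f_growth : exists2 gamma : R, 0 < gamma &
     \forall C \near +oo, forall T, 0 < T -> f (C * T) <= C `^ (- gamma) * f T)
  (Theta : 'M[R]_(n, m))
  (Theta_dirichlet : dirichlet f Theta^T)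
  (y : nat -> 'cV[int]_n)
  (y_best : ~ trivially_singular Theta^T -> best_approximations Theta^T y) :
  (forall (a : 'cV[R]_n) (L : {vspace 'cV[R]_n}),
     let A := affine_subspace a L in
     let Omega := asymptotic_directions Theta^T y in
     (0 < \dim L)%N ->
     (trivially_singular Theta^T -> ~ exceptional Theta^T A) ->
     orthogonal_complement L `&` Omega = set0 ->
     HAW_in (\dim L) A (BA Theta g `&` A))
  /\ HAW (BA Theta g).

Proof.
have haw d (M : 'M[R]_(n, d)) (a : 'cV[R]_n) : (0 < d)%N -> M^T *m M = 1%:M ->
    (forall z : 'cV[int]_n, z != 0 ->
      (exists p, Theta^T *m Zvec R z = Zvec R p) ->
      M^T *m Zvec R z != 0 \/ forall s : int, dot a (Zvec R z) != s%:~R) ->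
    (~ trivially_singular Theta^T -> exists (c : R) N, 0 < c /\
      forall i, (N <= i)%N ->
        c * enorm (Zvec R (y i)) <= enorm (M^T *m Zvec R (y i))) ->
    HAW ((fun x => a + M *m x) @^-1` BA Theta g).
  move=> d0 MM sing nsing.
  have [[z [z0 [p zp]]]|nsingular] := EM (trivially_singular Theta^T).
    apply: (HAW_singular hm hn f_gt0 f_cont f_decr f_inv f_cvg0 gE f_growth d0 zp).
    by apply: sing => //; exists p.
  have [c [N [c0 My]]] := nsing nsingular.
  exact: (HAW_nonsingular hm hn f_gt0 f_cont f_decr f_inv f_cvg0 gE f_growth
    Theta_dirichlet a d0 MM (y_best nsingular) c0 My).
split=> [a L A Omega dimL nexc disj|].
  have [M [MM ML]] := orthonormal_basis (erefl (\dim L)).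
  have phiA x : A (a + M *m x).
    by apply/mem_affine_subspace; rewrite addrC addKr; apply/ML; exists x.
  exists (fun x => a + M *m x); split=> [x x'||].
  - by rewrite opprD addrACA subrr add0r -mulmxBr enorm_isometry.
  - apply/seteqP; split=> [_ [x _ <-] //|u /mem_affine_subspace /ML[x uE]].
    by exists x => //; rewrite -uE addrC subrK.
  have -> : (fun x => a + M *m x) @^-1` (BA Theta g `&` A) =
            (fun x => a + M *m x) @^-1` BA Theta g.
    by apply/seteqP; split=> [x []|x] //.
  apply: haw => // [z z0 zp|nsing].
    have [Mz|] := eqVneq (M^T *m Zvec R z) 0; last by left.
    right=> s; apply/eqP => az; apply: nexc; first by exists z.
    exists z, s; split=> // _ [u uL <-]; have [x ->] := (ML u).1 uL.
    by rewrite /= dotDl az (dotC (M *m x)) dot_mulmx Mz dotC dot0r addr0.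
  apply: (projection_lower_bound MM _ nsing (best_neq0 (y_best nsing)) disj).
  by move=> u /ML.
have -> : BA Theta g = (fun x => 0 + 1%:M *m x) @^-1` BA Theta g.
  by apply/seteqP; split=> x /=; rewrite mul1mx add0r.
apply: haw => // [|z z0 _|_]; first by rewrite trmx1 mulmx1.
  left; rewrite trmx1 mul1mx -normr_gt0.
  exact: lt_le_trans ltr01 (norm_Zvec_ge1 R z0).
by exists 1, 0%N; split=> // i _; rewrite trmx1 mul1mx mul1r.
Qed.
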